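(* Let $0<\alpha<\pi/6$ with $\frac{\alpha}{\pi}$ rational, and let $\overline F=F\circ\overline T$ be the random billiard map in the infinite pipeline, i.e. $\overline F(s,\theta)=\overline F_i(s,\theta):=F(s,T_i(\theta))$ with probability $p_i(\theta)$, where $T_i,p_i$ ($i=1,\dots,4$) are the maps and probabilities of the Feres Random Map with parameter $\alpha$ and $F$ is the deterministic billiard map in the infinite pipeline. Then for all $(s,\theta)\in\mathbb R\times(0,\pi)$, all $\underline x\in\Sigma_\theta$ and every direction (nonzero vector) $\vec v\in\mathbb R^2$, the Lyapunov exponent is zero: $$\lambda_{\underline x}(\vec v,(s,\theta))=\lim_{n\to\infty}\frac1n\log\left\|D_{(s,\theta)}\overline F^{(n)}_{\underline x}\cdot\vec v\right\|=0.$$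
   Context: Infinite pipeline. The billiard table is a strip bounded by two parallel lines at distance $d>0$. A state is $(s,\theta)$, with $s\in\mathbb R$ the position of the impact point along the direction of the strip and $\theta\in(0,\pi)$ the angle between the strip direction and the outgoing trajectory; specular reflection preserves $\theta$, and the deterministic billiard map is $F(s,\theta)=(s_1(s,\theta),\theta)$ with $s_1(s,\theta)=s+d\cot\theta$. Feres Random Map. Fix $0<\alpha<\pi/6$. Put $T_1(\theta)=\theta+2\alpha$, $T_2(\theta)=-\theta+2\pi-4\alpha$, $T_3(\theta)=\theta-2\alpha$, $T_4(\theta)=-\theta+4\alpha$, and $u_a(\theta)=\frac12\left(1+\frac{\tan a}{\tan\theta}\right)$ (with $1/\tan(\pi/2)=0$). Define functions $p_i:[0,\pi]\to[0,1]$ by: $p_1(\theta)=1$ on $[0,\alpha)$, $u_\alpha(\theta)$ on $[\alpha,\pi-3\alpha)$, $2\cos(2\alpha)u_{2\alpha}(\theta)$ on $[\pi-3\alpha,\pi-2\alpha)$, $0$ on $[\pi-2\alpha,\pi]$; $p_2(\theta)=0$ on $[0,\pi-3\alpha)$, $u_\alpha(\theta)-2\cos(2\alpha)u_{2\alpha}(\theta)$ on $[\pi-3\alpha,\pi-2\alpha)$, $u_\alpha(\theta)$ on $[\pi-2\alpha,\pi-\alpha)$, $0$ on $[\pi-\alpha,\pi]$; $p_3(\theta)=0$ on $[0,2\alpha)$, $2\cos(2\alpha)u_{2\alpha}(-\theta)$ on $[2\alpha,3\alpha)$, $u_\alpha(-\theta)$ on $[3\alpha,\pi-\alpha)$, $1$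 on $[\pi-\alpha,\pi]$; $p_4(\theta)=0$ on $[0,\alpha)$, $u_\alpha(-\theta)$ on $[\alpha,2\alpha)$, $u_\alpha(-\theta)-2\cos(2\alpha)u_{2\alpha}(-\theta)$ on $[2\alpha,3\alpha)$, $0$ on $[3\alpha,\pi]$. The Feres Random Map $T$ sends $\theta$ to $T_i(\theta)$ with probability $p_i(\theta)$, $i=1,2,3,4$, and $\overline T(s,\theta)=(s,T_i(\theta))$ with probability $p_i(\theta)$. $\Sigma_\theta$ is the set of sequences $\underline x=(x_1,x_2,\dots)\in\{1,2,3,4\}^{\mathbb N}$ such that $p_{x_1}(\theta)\,p_{x_2}(T_{x_1}(\theta))\cdots p_{x_k}(T_{x_{k-1}}\circ\cdots\circ T_{x_1}(\theta))>0$ for all $k\ge1$. $\overline F^{(n)}_{\underline x}=\overline F_{x_n}\circ\cdots\circ\overline F_{x_1}$. *)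

(* Defs.v *)
From HB Require Import structures.
From mathcomp Require Export all_boot all_order all_algebra.
From mathcomp Require Export all_classical all_reals all_analysis.
Export Order.TTheory GRing.Theory Num.Theory.
Export numFieldNormedType.Exports.

Set Implicit Arguments.
Unset Strict Implicit.
Unset Printing Implicit Defensive.

#[local] Open Scope classical_set_scope.
#[local] Open Scope ring_scope.

Inductive index4 : Set := I1 | I2 | I3 | I4.

(** A random map with four branches: [z] is sent to [branch f i z] with
    probability [prob f i z]. *)
Record random_map (R : realType) (S : Type) := RandomMap {
  branch : index4 -> S -> S ;
  prob : index4 -> S -> R
}.

(** A sequence (x_1, x_2, ...) of indices is a function [x : nat -> index4]
    where [x k] stands for x_(k+1); thus [iterate f x n] is the map
    f_(x_n) \o ... \o f_(x_1). *)
Fixpoint iterate (R : realType) (S : Type) (f : random_map R S)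
    (x : nat -> index4) (n : nat) (z : S) : S :=
  if n is k.+1 then branch f (x k) (iterate f x k z) else z.

Definition admissible (R : realType) (S : Type) (f : random_map R S) (z : S) :
    set (nat -> index4) :=
  [set x : nat -> index4 | forall k : nat, (1 <= k)%N ->
     0 < \prod_(j < k) prob f (x j) (iterate f x j z)].

(** The random map [G \o f]: first apply [f], then the deterministic [G]. *)
Definition compose_random (R : realType) (S : Type) (G : S -> S)
    (f : random_map R S) : random_map R S :=
  RandomMap (fun i z => G (branch f i z)) (prob f).

Section Feres.
Variables (R : realType) (alpha : R).
Implicit Types a theta : R.

Definition feres_branch (i : index4) theta : R :=
  match i with
  | I1 => theta + 2 * alpha
  | I2 => - theta + 2 * pi - 4 * alpha
  | I3 => theta - 2 * alpha
  | I4 => - theta + 4 * alpha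
  end.

(** Since [tan (pi / 2)] and [0^-1] are both [0], the convention
    1 / tan (pi / 2) = 0 holds here, and likewise at [- (pi / 2)]. *)
Definition u a theta : R := 2^-1 * (1 + tan a / tan theta).

(** The probabilities are functions on [[0, pi]]; outside of it the value is
    the junk value [0]. *)
Definition feres_prob (i : index4) theta : R :=
  match i with
  | I1 =>
    if 0 <= theta < alpha then 1
    else if alpha <= theta < pi - 3 * alpha then u alpha theta
    else if pi - 3 * alpha <= theta < pi - 2 * alpha then
      2 * cos (2 * alpha) * u (2 * alpha) theta
    else 0
  | I2 =>
    if pi - 3 * alpha <= theta < pi - 2 * alpha then
      u alpha theta - 2 * cos (2 * alpha) * u (2 * alpha) theta
    else if pi - 2 * alpha <= theta < pi - alpha then u alpha theta
    else 0
  | I3 =>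
    if 2 * alpha <= theta < 3 * alpha then
      2 * cos (2 * alpha) * u (2 * alpha) (- theta)
    else if 3 * alpha <= theta < pi - alpha then u alpha (- theta)
    else if pi - alpha <= theta <= pi then 1
    else 0
  | I4 =>
    if alpha <= theta < 2 * alpha then u alpha (- theta)
    else if 2 * alpha <= theta < 3 * alpha then
      u alpha (- theta) - 2 * cos (2 * alpha) * u (2 * alpha) (- theta)
    else 0
  end.

Definition feres_map : random_map R R := RandomMap feres_branch feres_prob.

End Feres.

(** The Feres random map acting on states (s, theta), fixing s. *)
Definition feres_state_map (R : realType) (alpha : R) : random_map R (R * R) :=
  RandomMap (fun i z => (z.1, branch (feres_map alpha) i z.2))
            (fun i z => prob (feres_map alpha) i z.2).

Definition cot (R : realType) (theta : R) : R := cos theta / sin theta.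

(** The billiard map of the pipeline of width [d]. The state space is
    R x (0, pi); the map is extended to the whole plane by the same formula. *)
Definition pipeline_map (R : realType) (d : R) (z : R * R) : R * R :=
  (z.1 + d * cot z.2, z.2).

Definition pipeline_random_map (R : realType) (d alpha : R) :
    random_map R (R * R) :=
  compose_random (pipeline_map d) (feres_state_map alpha).

(** The library norm on [R * R] is the sup norm. *)
Definition enorm (R : realType) (v : R * R) : R :=
  Num.sqrt (v.1 ^+ 2 + v.2 ^+ 2).

(** lambda_x(v, z) exists and equals [l]. As ['d] and [ln] are total functions,
    the first two clauses state that the derivatives exist and that the
    logarithms are those of positive numbers. *)
Definition has_lyapunov_exponent (R : realType) (f : random_map R (R * R))
    (x : nat -> index4) (v z : R * R) (l : R) : Prop :=
  [/\ forall n : nat, differentiable (iterate f x n) z,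
      forall n : nat, 0 < enorm ('d (iterate f x n) z v)
    & (fun n : nat => n%:R^-1 * ln (enorm ('d (iterate f x n) z v)))
        @ \oo --> l].

(* Main.v *)
(** The derivatives of the iterates are upper triangular, of the form
    [[1, c_n], [0, +-1]], where c_n sums n terms of absolute value
    d / sin(theta_k)^2. As alpha / pi is rational, the angles theta_k stay in a
    finite subset of (0, pi), so c_n grows at most linearly, while the norm of
    the image of v stays bounded away from 0. *)
Require Import Defs.
From mathcomp Require Import ring lra zify.

Set Implicit Arguments.
Unset Strict Implicit.
Unset Printing Implicit Defensive.

Local Open Scope classical_set_scope.
Local Open Scope ring_scope.

(** * Angles along an admissible orbit *)

Lemma feres_branch_interval (R : realType) (alpha theta : R) (i : index4) :
  0 < alpha -> alpha < pi / 6 -> 0 < theta < pi ->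
  0 < feres_prob alpha i theta -> 0 < feres_branch alpha i theta < pi.
Proof.
move=> a0 a6 /andP[t0 tpi].
(* This makes [tan (2 * alpha) / tan (2 * alpha)] equal to 1 rather than the default 0, so that
   [u (2 * alpha)] vanishes at [- (2 * alpha)]. *)
have tan2a : tan (2 * alpha) != 0.
  rewrite /tan; apply: mulf_neq0; last rewrite invr_eq0.
    by apply: lt0r_neq0; apply: sin_gt0_pihalf; lra.
  by apply: lt0r_neq0; apply: cos_gt0_pihalf; lra.
case: i; rewrite /feres_prob /feres_branch.
- case: ifP => [/andP[]|_]; first by move=> *; lra.
  case: ifP => [/andP[]|_]; first by move=> *; lra.
  case: ifP => [/andP[]|_]; first by move=> *; lra.
  by rewrite ltxx.
- case: ifP => [/andP[]|_]; first by move=> *; lra.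
  case: ifP => [/andP[]|_]; first by move=> *; lra.
  by rewrite ltxx.
- case: ifP => [/andP[]|_].
    rewrite le_eqVlt => /predU1P[<-|]; last by move=> *; lra.
    (* the entry point [theta = 2 alpha] of this branch is mapped to [0], but
       its probability vanishes there *)
    by rewrite /u tanN invrN mulrN divff// subrr !mulr0 ltxx.
  case: ifP => [/andP[]|_]; first by move=> *; lra.
  case: ifP => [/andP[]|_]; first by move=> *; lra.
  by rewrite ltxx.
- case: ifP => [/andP[]|_]; first by move=> *; lra.
  case: ifP => [/andP[]|_]; first by move=> *; lra.
  by rewrite ltxx.
Qed.

(** Two consecutive partial products are positive, hence so is the factor by which they differ; the
    empty product is treated apart because admissibility starts at one factor. *)
Lemma admissible_prob_gt0 (R : realType) (S : Type) (f : random_map R S) z x :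
  admissible f z x -> forall k, 0 < prob f (x k) (iterate f x k z).
Proof.
move=> adm k; have := adm k.+1 isT; rewrite big_ord_recr/=.
case: k => [|k]; first by rewrite big_ord0 mul1r.
by rewrite pmulr_rgt0//; exact: adm.
Qed.

Lemma feres_orbit_interval (R : realType) (alpha theta : R) x :
  0 < alpha -> alpha < pi / 6 -> 0 < theta < pi ->
  admissible (feres_map alpha) theta x ->
  forall n, 0 < iterate (feres_map alpha) x n theta < pi.
Proof.
move=> a0 a6 th adm; elim=> [|n IHn] //=.
exact: feres_branch_interval a0 a6 IHn (admissible_prob_gt0 adm n).
Qed.

(** Each branch is a sign change or the identity followed by a translation in the lattice generated
    by [delta]. The sign stands outside the sum so that $\sin^2$ is the same in both cases. *)
Lemma feres_orbit_lattice (R : realType) (alpha theta delta : R) (p q : int) x :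
  alpha = p%:~R * delta -> pi = q%:~R * delta ->
  forall n, exists m : int,
    iterate (feres_map alpha) x n theta = theta + m%:~R * delta \/
    iterate (feres_map alpha) x n theta = - (theta + m%:~R * delta).
Proof.
move=> ap piq; elim=> [|n [m IHn]]; first by exists 0; left; rewrite mul0r addr0.
rewrite /=; case: (x n) => /=; case: IHn => ->; rewrite ap ?piq.
- by exists (m + 2 * p); left; rewrite !(intrD, intrM); ring.
- by exists (m - 2 * p); right; rewrite !(intrD, intrM, intrN); ring.
- by exists (m - 2 * q + 4 * p); right; rewrite !(intrD, intrM, intrN); ring.
- by exists (m + 2 * q - 4 * p); left; rewrite !(intrD, intrM, intrN); ring.
- by exists (m - 2 * p); left; rewrite !(intrD, intrM, intrN); ring.
- by exists (m + 2 * p); right; rewrite !(intrD, intrM, intrN); ring.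
- by exists (m - 4 * p); right; rewrite !(intrD, intrM, intrN); ring.
- by exists (m + 4 * p); left; rewrite !(intrD, intrM, intrN); ring.
Qed.

(* The orbit is a bounded part of [+-theta + delta * int], hence finite; the sum
   over all candidate angles is a crude bound that avoids taking a maximum. *)
Lemma feres_orbit_sin_bound (R : realType) (alpha theta : R) x :
  0 < alpha -> alpha < pi / 6 -> (exists q : rat, alpha / pi = ratr q) ->
  0 < theta < pi -> admissible (feres_map alpha) theta x ->
  exists C : R, forall n,
    (sin (iterate (feres_map alpha) x n theta) ^+ 2)^-1 <= C.
Proof.
move=> a0 a6 [r ar] th adm.
pose D := `|denq r|%N.
have D0 : (0 < D)%N by rewrite absz_gt0 denq_neq0.
have denE : denq r = D%:Z by rewrite /D absz_denq.
pose delta : R := pi / D%:R.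
have piE : pi = (D%:Z)%:~R * delta :> R.
  by rewrite /delta mulrC divfK// pnatr_eq0 -lt0n.
have pi0 : 0 < pi :> R by exact: pi_gt0.
have delta0 : 0 < delta by rewrite divr_gt0// ltr0n.
have aE : alpha = (numq r)%:~R * delta.
  rewrite -[LHS](divfK (lt0r_neq0 pi0)) ar /ratr denE /delta.
  by rewrite mulrAC mulrA.
pose g t : R := (sin t ^+ 2)^-1.
have g0 t : 0 <= g t by rewrite invr_ge0 sqr_ge0.
(* Both [theta] and the orbit point lie in $(0,\pi)$, so $|m|\delta < 2\pi = 2D\delta$. *)
pose N := (2 * D)%N.
exists (\sum_(j < N) (g (theta + j%:R * delta) + g (theta - j%:R * delta))).
move=> n.
have := feres_orbit_interval a0 a6 th adm n.
have [m] := feres_orbit_lattice theta x aE piE n.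
set t := iterate _ _ _ _ => tE /andP[t0 tpi].
have -> : (sin t ^+ 2)^-1 = g (theta + m%:~R * delta).
  by case: tE => ->; rewrite /g ?sinN ?sqrrN.
have mN : (`|m| < N)%N.
  have : `|m%:~R * delta| < 2 * pi.
    rewrite ltr_norml; case/andP: th => th0 thpi.
    by case: tE => tE; apply/andP; split; lra.
  rewrite piE [2 * _]mulrA normrM (gtr0_norm delta0) ltr_pM2r//.
  by rewrite -intr_norm -[2]/(2%:~R) -intrM ltr_int /N; lia.
rewrite (bigD1 (Ordinal mN))//= -[leLHS]addr0 lerD ?sumr_ge0//; last first.
  by move=> j _; rewrite addr_ge0.
(* The sign of [m] decides which half of the summand of index $|m|$ is the required value. *)
case: (m) => k /=; first by rewrite lerDl.
by rewrite NegzE intrN mulNr lerDr.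
Qed.

(** * Differentials of the iterates *)

(** One step of the pipeline has this form, with $g = d\cot\circ T_i$ and $h = T_i$. *)
Lemma is_diff_shear (R : realType) (g h : R -> R) (g' h' : R) (z : R * R) :
  is_derive z.2 1 g g' -> is_derive z.2 1 h h' ->
  is_diff z (fun w : R * R => (w.1 + g w.2, h w.2))
    (fun v => (v.1 + g' * v.2, h' * v.2)).
Proof.
have snd_diff : is_diff z (@snd R R) snd.
  have snd_cont : continuous (@snd R R) by move=> w; exact: cvg_snd.
  by apply: DiffDef; [exact: linear_differentiable | exact: diff_lin].
have fst_diff : is_diff z (@fst R R) fst.
  have fst_cont : continuous (@fst R R) by move=> w; exact: cvg_fst.
  by apply: DiffDef; [exact: linear_differentiable | exact: diff_lin].
have comp_snd (k : R -> R) (k' : R) : is_derive z.2 1 k k' ->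
    is_diff z (fun w : R * R => k w.2) (fun v => k' * v.2).
  move=> [dk kE].
  have kd : is_diff (z.2) k (fun v => k' * v).
    have kdiff : differentiable k z.2 by exact/derivable1_diffP.
    apply: DiffDef => //; apply/funext => v.
    by rewrite diff1E// derive1E kE mulrC.
  exact: (is_diff_comp snd_diff kd).
move=> /comp_snd dg /comp_snd dh.
have dfst : is_diff z (fun w : R * R => w.1 + g w.2) (fun v => v.1 + g' * v.2).
  exact: (is_diffD fst_diff dg).
exact: is_diff_pair.
Qed.

Definition feres_slope (R : realType) (i : index4) : R :=
  match i with I1 | I3 => 1 | I2 | I4 => -1 end.

Lemma feres_slope_norm (R : realType) i : `|feres_slope R i| = 1.
Proof. by case: i; rewrite ?normrN normr1. Qed.

Lemma is_derive_feres_branch (R : realType) (alpha theta : R) i :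
  is_derive theta 1 (feres_branch alpha i) (feres_slope R i).
Proof.
by case: i; apply: is_derive_eq; rewrite /= ?subr0 ?addr0.
Qed.

Lemma is_derive_cot (R : realType) (theta : R) : sin theta != 0 ->
  is_derive theta 1 (@cot R) (- (sin theta ^+ 2)^-1).
Proof.
move=> s0; have dV := is_deriveV s0 (is_derive_sin theta).
apply: is_derive_eq.
transitivity (- (cos theta ^+ 2 + sin theta ^+ 2) / sin theta ^+ 2).
  by rewrite /GRing.scale/=; field.
by rewrite cos2Dsin2 mulN1r.
Qed.

Lemma is_diff_pipeline_branch (R : realType) (d alpha : R) i (z : R * R) :
  let t := feres_branch alpha i z.2 in sin t != 0 ->
  is_diff z (branch (pipeline_random_map d alpha) i)
    (fun v => (v.1 - d * (sin t ^+ 2)^-1 * feres_slope R i * v.2,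
               feres_slope R i * v.2)).
Proof.
move=> t st0.
have dh := is_derive_feres_branch alpha z.2 i.
have dcot := is_derive_cot st0.
have dg : is_derive z.2 1 (fun w => d * cot (feres_branch alpha i w))
    (- (d * (sin t ^+ 2)^-1 * feres_slope R i)).
  have dgh := is_derive1_comp dcot dh.
  have -> : - (d * (sin t ^+ 2)^-1 * feres_slope R i) =
      d *: (- (sin t ^+ 2)^-1 * feres_slope R i) by rewrite /GRing.scale/=; ring.
  exact: is_deriveZ.
have := is_diff_shear dg dh.
by under [X in is_diff _ _ X]eq_fun do rewrite mulNr.
Qed.

Lemma iterate_pipeline_angle (R : realType) (d alpha : R) x (z : R * R) n :
  (iterate (pipeline_random_map d alpha) x n z).2 =
  iterate (feres_map alpha) x n z.2.
Proof. by elim: n => //= n ->. Qed.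

Lemma is_diff_iterate_pipeline (R : realType) (d alpha C : R) x (z : R * R) :
  0 <= d ->
  (forall n, sin (iterate (feres_map alpha) x n z.2) != 0) ->
  (forall n, (sin (iterate (feres_map alpha) x n z.2) ^+ 2)^-1 <= C) ->
  forall n, exists c e : R, [/\ `|c| <= d * C * n%:R, `|e| = 1 &
    is_diff z (iterate (pipeline_random_map d alpha) x n)
      (fun v => (v.1 + c * v.2, e * v.2))].
Proof.
move=> d0 s0 sC; elim=> [|n [c [e [cn e1 IHn]]]].
  exists 0, 1; rewrite normr0 mulr0 normr1; split=> //.
  have := is_diff_id z.
  by under [X in _ -> is_diff _ _ X]eq_fun
    do rewrite mul0r addr0 mul1r -surjective_pairing.
(* The index is [n.+1] because the cotangent is taken at the angle after the Feres branch has
   acted. *)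
have := s0 n.+1; have := sC n.+1; rewrite /= -(iterate_pipeline_angle d).
set w := iterate _ _ _ _; set t := feres_branch _ _ _ => tC t0.
(* Entries of the product of the one-step triangular matrix with the previous one; the corner entry
   changes by at most $dC$. *)
exists (c - d * (sin t ^+ 2)^-1 * feres_slope R (x n) * e),
  (feres_slope R (x n) * e).
split.
- rewrite -natr1 mulrDr mulr1 (le_trans (ler_normB _ _))// lerD//.
  rewrite !normrM e1 feres_slope_norm !mulr1 ger0_norm// ler_wpM2l//.
  by rewrite ger0_norm// invr_ge0 sqr_ge0.
- by rewrite normrM e1 feres_slope_norm mulr1.
apply: (is_diff_eq (is_diff_comp IHn (is_diff_pipeline_branch d t0))).
by apply/funext => v /=; congr pair; ring.
Qed.

(** * Linear growth and the exponent *)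

Lemma cvg_ln_linear_growth (R : realType) (A B : R) (u : nat -> R) :
  0 < A -> (forall n, A <= u n) -> (forall n, u n <= B * n.+1%:R) ->
  (fun n => n%:R^-1 * ln (u n)) @ \oo --> (0 : R).
Proof.
move=> A0 Au uB.
have B0 : 0 < B.
  by have := lt_le_trans A0 (le_trans (Au 0%N) (uB 0%N)); rewrite mulr1.
rewrite -cvg_shiftS.
have h0 := @cvg_harmonic R.
have sqrt0 : Num.sqrt (@harmonic R n) @[n --> \oo] --> (0 : R).
  rewrite -[X in _ --> X]sqrtr0.
  by apply: continuous_cvg h0; exact: sqrt_continuous.
(* With $m = n+1$, the hypothesis gives $u_m \le B(m+1) \le 2Bm$, and $\ln m = 2\ln\sqrt m < 2\sqrt
   m$; dividing by $m$ yields the upper bound $\ln(2B)/m + 2/\sqrt m$. *)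
apply: (@squeeze_cvgr _ _ _ _ (fun n => harmonic n * ln A)
  (fun n => harmonic n * ln (2 * B) + 2 * Num.sqrt (harmonic n))).
- near=> n; rewrite /harmonic/=.
  have n0 : 0 < n.+1%:R :> R by rewrite ltr0n.
  have i0 : 0 < n.+1%:R^-1 :> R by rewrite invr_gt0.
  have u0 := lt_le_trans A0 (Au n.+1).
  rewrite ler_pM2l// ler_ln ?posrE// Au/=.
  have r0 : 0 < Num.sqrt n.+1%:R :> R by rewrite sqrtr_gt0.
  have rr : n.+1%:R = Num.sqrt n.+1%:R * Num.sqrt n.+1%:R :> R.
    by rewrite -expr2 sqr_sqrtr// ltW.
  have -> : 2 * Num.sqrt n.+1%:R^-1 = n.+1%:R^-1 * (2 * Num.sqrt n.+1%:R) :> R.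
    by rewrite sqrtrV ?ltW// {2}rr; field; rewrite lt0r_neq0.
  rewrite -mulrDr ler_pM2l//.
  have uB2 : u n.+1 <= 2 * B * n.+1%:R.
    rewrite (le_trans (uB _))// [2 * B]mulrC -mulrA ler_pM2l//.
    by rewrite -natrM ler_nat; lia.
  have B20 : 0 < 2 * B by rewrite mulr_gt0.
  have := uB2; rewrite -ler_ln ?posrE ?mulr_gt0// lnM ?posrE// => /le_trans; apply.
  rewrite lerD2l {1}rr lnM ?posrE// mulr_natl mulr2n.
  by rewrite lerD// ltW// ln_sublinear.
- by rewrite -[X in _ --> X](mul0r (ln A)); exact: cvgMl.
- rewrite -[X in _ --> X](addr0 0) -[X in _ --> X + _](mul0r (ln (2 * B))).
  rewrite -[X in _ --> _ + X](mulr0 2).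
  by apply: cvgD; [exact: cvgMl | exact: cvgMr].
Unshelve. all: by end_near. Qed.

Lemma enorm_ge_fst (R : realType) (v : R * R) : `|v.1| <= enorm v.
Proof. by rewrite -sqrtr_sqr ler_wsqrtr// lerDl sqr_ge0. Qed.

Lemma enorm_ge_snd (R : realType) (v : R * R) : `|v.2| <= enorm v.
Proof. by rewrite -sqrtr_sqr ler_wsqrtr// lerDr sqr_ge0. Qed.

Lemma enorm_le_sum (R : realType) (v : R * R) : enorm v <= `|v.1| + `|v.2|.
Proof.
rewrite -[leRHS]ger0_norm ?addr_ge0// -sqrtr_sqr ler_wsqrtr//.
by rewrite sqrrD !real_normK ?num_real// addrAC lerDl mulrn_wge0 ?mulr_ge0.
Qed.

Theorem propositionA1 (R : realType) (d alpha : R)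
    (d_gt0 : 0 < d) (alpha_gt0 : 0 < alpha) (alpha_lt : alpha < pi / 6)
    (alpha_rat : exists q : rat, alpha / pi = ratr q)
    (s theta : R) (theta_gt0 : 0 < theta) (theta_lt : theta < pi)
    (x : nat -> index4) (hx : admissible (feres_map alpha) theta x)
    (v : R * R) (v_neq0 : v != 0) :
  has_lyapunov_exponent (pipeline_random_map d alpha) x v (s, theta) 0.
Proof.
have th : 0 < theta < pi by apply/andP.
have [C sC] := feres_orbit_sin_bound alpha_gt0 alpha_lt alpha_rat th hx.
have s0 n : sin (iterate (feres_map alpha) x n theta) != 0.
  by rewrite lt0r_neq0// sin_gt0_pi//; exact: feres_orbit_interval.
have dn := @is_diff_iterate_pipeline _ _ _ _ _ (s, theta) (ltW d_gt0) s0 sC.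
have C0 : 0 <= C by rewrite (le_trans _ (sC 0%N))// invr_ge0 sqr_ge0.
(* The differentials preserve $|v_2|$, and they fix [v] when $v_2 = 0$, so this bounds the norm of
   every image from below. *)
pose A := if v.2 == 0 then `|v.1| else `|v.2|.
have A0 : 0 < A.
  rewrite /A; case: (eqVneq v.2 0) => [v20|v20]; rewrite normr_gt0//.
  by apply: contra_neq v_neq0 => v10; rewrite [v]surjective_pairing v10 v20.
have lower n :
    A <= enorm ('d (iterate (pipeline_random_map d alpha) x n) (s, theta) v).
  have [c [e [_ e1 [_ ->]]]] := dn n; rewrite /A; case: eqP => [v20|_].
    by rewrite (le_trans _ (enorm_ge_fst _))//= v20 mulr0 addr0.
  by rewrite (le_trans _ (enorm_ge_snd _))//= normrM e1 mul1r.
split=> [n|n|]; first by have [c [e [_ _ []]]] := dn n.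
  exact: lt_le_trans (lower n).
(* The norm is at most $|v_1| + dCn|v_2| + |v_2|$, and each term is dominated by its coefficient
   times $n+1$. *)
apply: (@cvg_ln_linear_growth _ A (`|v.1| + (1 + d * C) * `|v.2|)) => // n.
have [c [e [cn e1 [_ ->]]]] := dn n.
rewrite (le_trans (enorm_le_sum _))//= normrM e1 mul1r.
have : `|v.1 + c * v.2| <= `|v.1| + d * C * n%:R * `|v.2|.
  by rewrite (le_trans (ler_normD _ _))// lerD2l normrM ler_wpM2r.
have dC0 : 0 <= d * C by rewrite mulr_ge0// ltW.
have := mulr_ge0 (ler0n R n) (normr_ge0 v.1).
have := mulr_ge0 (ler0n R n) (normr_ge0 v.2).
have := mulr_ge0 dC0 (normr_ge0 v.2).
rewrite -natr1.
by nra.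
Qed.
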